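(* A position in $\mathcal{F}$-Wythoff is a $\mathcal{P}$-position if and only if it is an element of the set $$\{(0,0)\}\cup\{(\lfloor \phi n \rfloor+1,\ \lfloor \phi^2 n \rfloor +1) \mid n \in \mathbb{Z},\ n\geq 0 \}.$$
   Context: $\phi = (1+\sqrt5)/2$ and $\lfloor\cdot\rfloor$ is the integer part. A position is an unordered pair $(a,b)$ of nonnegative integers (two piles of tokens); $(a,b)$ is identified with $(b,a)$. $\mathcal{F}$-Wythoff is the impartial two-player game with the following legal moves: (i) remove any positive number of tokens from one pile; (ii) remove the same positive number $k$ of tokens from both piles, provided the integer ratio of the two entries does not change, i.e. from $(a,b)$ with $1\le a\le b$ one may move to $(a-k,b-k)$ with $1\le k<a$ if $\lfloor (b-k)/(a-k)\rfloor=\lfloor b/a\rfloor$. Players alternate moves; the player first unable to move loses. A position is an $\mathcal{N}$-position if the player about to move has a winning strategy, and a $\mathcal{P}$-position otherwise. *)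

(* Defs.v *)
From mathcomp Require Import all_boot all_order all_algebra.
From mathcomp Require Import classical_sets reals.

Set Implicit Arguments.
Unset Strict Implicit.
Unset Printing Implicit Defensive.

Section Impartial.
Variables (T : Type) (move : T -> T -> Prop).

(* [wins sigma p]: the player about to move at [p] who follows [sigma] always
   has a legal move available and makes the last move of the play, whatever
   the opponent does.  Being inductive, it only admits finite plays. *)
Inductive wins (sigma : T -> T) (p : T) : Prop :=
  Wins of move p (sigma p)
        & forall q, move (sigma p) q -> wins sigma q.

Definition N_position (p : T) : Prop := exists sigma : T -> T, wins sigma p.
Definition P_position (p : T) : Prop := ~ N_position p.
End Impartial.

(* An unordered pair of naturals is represented by its sorted form. *)
Definition position := {p : nat * nat | p.1 <= p.2}.

Lemma pos_subproof (a b : nat) : (minn a b, maxn a b).1 <= (minn a b, maxn a b).2.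
Proof. by rewrite /= geq_min !leq_max !leqnn. Qed.

Definition pos (a b : nat) : position :=
  exist _ (minn a b, maxn a b) (pos_subproof a b).

Lemma posC (a b : nat) : pos a b = pos b a.
Proof. by apply: val_inj; rewrite /= minnC maxnC. Qed.

Lemma posE (p : position) : p = pos (val p).1 (val p).2.
Proof.
by apply: val_inj; case: p => -[a b] /= le_ab; rewrite (minn_idPl le_ab) (maxn_idPr le_ab).
Qed.

(* By [posC], [FWone] removes tokens from either pile. *)
Inductive FW_move : position -> position -> Prop :=
| FWone (a b k : nat) of 1 <= k <= b : FW_move (pos a b) (pos a (b - k))
| FWboth (a b k : nat) of 1 <= a <= b & 1 <= k < a
    & (b - k) %/ (a - k) = b %/ a : FW_move (pos a b) (pos (a - k) (b - k)).

Import GRing.Theory Num.Theory.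
Local Open Scope classical_set_scope.
Local Open Scope ring_scope.

Definition phi (R : realType) : R := (1 + Num.sqrt 5) / 2.

(* [Num.floor] is integer-valued whereas pile sizes are naturals, hence the
   equations in [int] rather than a truncating conversion. *)
Definition FW_set (R : realType) : set position :=
  [set pos 0 0] `|`
  [set p | exists2 n : int, 0 <= n &
     exists a b : nat,
       [/\ a%:Z = Num.floor (phi R * n%:~R) + 1,
           b%:Z = Num.floor (phi R ^+ 2 * n%:~R) + 1
         & p = pos a b]].

(* Main.v *)
Require Import Defs.
From mathcomp Require Import all_boot all_order all_algebra.
From mathcomp Require Import classical_sets reals.
From mathcomp Require Import boolp zify ring lra.

(** Write A_n = floor (phi n) and B_n = floor (phi^2 n) = A_n + n.  Every
    positive integer is exactly one of the A_n, B_n with n > 0, by Beatty's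
    argument.  Hence, as in Wythoff's game, no two of the candidate positions
    (A_n + 1, B_n + 1) share an entry or a difference, so no move joins
    them, and (0, 0) is out of their reach since their entries are positive.
    From any other position the classical Wythoff move to a candidate is still
    legal: when it removes from both piles, the ratios before and after are both
    1, because B_n <= 2 A_n. *)

Import Order.TTheory GRing.Theory Num.Theory.

(** Outside [S] the strategy always moves into [S], the opponent has to leave it again, and [size]
    bounds the length of the play. Within [S] the roles are exchanged: any move can be answered by a
    return to [S], so no finite win exists there. *)
Lemma P_position_kernel {T : Type} (move : T -> T -> Prop) (S : set T)
    (size : T -> nat) :
  (forall p q, move p q -> size q < size p) ->
  (forall p q, S p -> move p q -> ~ S q) ->
  (forall p, ~ S p -> exists2 q, move p q & S q) ->
  forall p, P_position move p <-> S p.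
Proof.
move=> size_lt S_stable S_absorb p; split; last first.
  move=> Sp [sigma wp]; elim: wp Sp => {}p mv _ IH Sp.
  by have [q mq Sq] := S_absorb _ (S_stable _ _ Sp mv); exact: IH mq Sq.
apply: contra_notP => nSp.
have /choice[sigma sigmaP] : forall p, exists q, ~ S p -> move p q /\ S q.
  move=> q; have [Sq|/S_absorb[r mr Sr]] := pselect (S q); last by exists r.
  by exists q => /(_ Sq).
exists sigma; have [n] := ubnP (size p); elim: n p nSp => [p _|n IH p nSp].
  by rewrite ltn0.
rewrite ltnS => le_pn.
have [mv Sq] := sigmaP _ nSp; apply: Wins (mv) _ => q mq.
apply: IH; first exact: S_stable mq.
by have := size_lt _ _ mv; have := size_lt _ _ mq; lia.
Qed.

Lemma pos_inj (a b c d : nat) :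
  pos a b = pos c d -> a = c /\ b = d \/ a = d /\ b = c.
Proof. by move=> /(congr1 val)[]; lia. Qed.

Definition pos_size (p : position) : nat := (val p).1 + (val p).2.

Lemma FW_move_size (p q : position) : FW_move p q -> pos_size q < pos_size p.
Proof. by case=> [a b k|a b k]; rewrite /pos_size /=; lia. Qed.

(** A one-pile move keeps an entry, which sorting may put in either place; a move on both piles
    keeps the difference and empties no pile. *)
Lemma FW_move_inv (a b c d : nat) :
  FW_move (pos a b) (pos c d) -> a <= b -> c <= d ->
  c = a \/ d = a \/ d = b \/ c = b \/ 0 < c /\ d - c = b - a.
Proof.
move=> mv le_ab le_cd; move: mv; move eP: (pos a b) => P; move eQ: (pos c d) => Q mv.
by case: P Q / mv eP eQ => [x y k kP|x y k xP kP _] /pos_inj eP /pos_inj eQ; lia.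
Qed.

Section GoldenBeatty.
Variable R : realType.
Local Notation phi := (phi R).
Local Open Scope ring_scope.

Lemma phi_sqr : phi ^+ 2 = phi + 1.
Proof.
have := @sqr_sqrtr R 5 (ler0n _ _).
rewrite /Defs.phi; move: (Num.sqrt 5) => s s2.
by rewrite expr_div_n sqrrD s2; field.
Qed.

Lemma phi_gt1 : 1 < phi.
Proof.
have : 1 < Num.sqrt (5 : R) by rewrite -{1}sqrtr1 ltr_sqrt ?ltr1n ?ltr0n.
by rewrite /Defs.phi; move: (Num.sqrt 5) => s; lra.
Qed.

Lemma phi_irrational (n a : nat) : phi * n%:R = a%:R -> n = 0%N.
Proof.
case: n => // n; set m := n.+1 => e; exfalso.
(* Clear denominators in [phi ^+ 2 = phi + 1], then complete the square. *)
have eZ : (a * a = a * m + m * m)%N.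
  apply/eqP; rewrite -(eqr_nat R) natrD !natrM -e.
  by apply/eqP; have := phi_sqr; move: phi => t t2; ring: t2.
(* The 5-adic valuations of the two sides have different parities. *)
have e5 : (5 * (m * m) = ((2 * a - m) * (2 * a - m)))%N.
  have : (m <= 2 * a)%N by nia.
  by move=> h; nia.
have m0 : (0 < m)%N by [].
have c0 : (0 < 2 * a - m)%N by nia.
have := congr1 (logn 5) e5.
by rewrite !lognM ?muln_gt0 ?m0 ?c0 // (logn_prime 5) //=; lia.
Qed.

(* [golden_floor n a] says that [a] is the integer part of [phi * n]; that of
   [phi ^+ 2 * n] is then [a + n]. *)
Definition golden_floor (n a : nat) : bool :=
  (a%:R <= phi * n%:R :> R) && (phi * n%:R < a.+1%:R).

Lemma golden_floor_floor (n a : nat) :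
  golden_floor n a = (a%:Z == Num.floor (phi * n%:R)).
Proof. by rewrite eq_sym floor_eq /golden_floor intrD natr1. Qed.

Lemma golden_floor_ex (n : nat) : exists a : nat, golden_floor n a.
Proof.
have : 0 <= Num.floor (phi * n%:R).
  by rewrite floor_ge0 mulr_ge0 // ltW // (lt_trans ltr01 phi_gt1).
case: (Num.floor _) (golden_floor_floor n) => // a fE _.
by exists a; rewrite fE.
Qed.

Lemma golden_floor_mono (m n a b : nat) :
  golden_floor m a -> golden_floor n b -> (m < n)%N -> (a < b)%N.
Proof.
move=> /andP[a_le _] /andP[_ b_gt]; rewrite -(ler_nat R) -!natr1 => mn.
rewrite -ltnS -(ltr_nat R); apply: le_lt_trans b_gt.
by have := phi_gt1; rewrite -natr1; nra.
Qed.

Lemma golden_floor_inj (m n a : nat) :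
  golden_floor m a -> golden_floor n a -> m = n.
Proof.
move=> ma na; have [mn|nm|//] := ltngtP m n.
  by have := golden_floor_mono _ _ _ _ ma na mn; lia.
by have := golden_floor_mono _ _ _ _ na ma nm; lia.
Qed.

Lemma golden_floor_fun (n a b : nat) :
  golden_floor n a -> golden_floor n b -> a = b.
Proof. by rewrite !golden_floor_floor => /eqP ea /eqP; rewrite -ea => -[]. Qed.

Lemma golden_floor_ge (n a : nat) : golden_floor n a -> (n <= a)%N.
Proof.
move=> /andP[_]; rewrite -ltnS -(ltr_nat R); apply: le_lt_trans.
by rewrite ler_peMl // ltW // phi_gt1.
Qed.

(** For n > 0, a common value a = A_n = B_m would force a < n + m < a + 1, because 1/phi + 1/phi^2 =
    1. *)
Lemma golden_floor_disjoint (m n b : nat) :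
  golden_floor m b -> golden_floor n (b + m) -> m = 0%N.
Proof.
set a := (b + m)%N => /andP[b_le b_gt] /andP[a_le a_gt].
have [n0|n_gt0] := posnP n.
  by move: a_le; rewrite n0 mulr0 (ler_nat R _ 0) leqn0 addn_eq0 => /andP[_ /eqP].
exfalso.
have {a_le} a_lt : a%:R < phi * n%:R.
  rewrite lt_neqAle a_le andbT eq_sym; apply/eqP => /phi_irrational n0.
  by rewrite n0 in n_gt0.
have t_gt0 : 0 < phi := lt_trans ltr01 phi_gt1.
have aE : a%:R = b%:R + m%:R :> R by rewrite natrD.
(* Weigh the bounds on [n] by [phi] and those on [m] by [1], and divide the sum
   by [phi + 1 = phi ^+ 2]. *)
have sum_gt0 (u v w : R) : 0 < u -> 0 <= v -> phi ^+ 2 * w = phi * u + v -> 0 < w.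
  move=> u0 v0 e; rewrite -(pmulr_rgt0 w (exprn_gt0 2 t_gt0)) e.
  by rewrite ltr_wpDr // mulr_gt0.
have lo : (a < n + m)%N.
  rewrite -(ltr_nat R) natrD -subr_gt0.
  apply: (sum_gt0 (phi * n%:R - a%:R) (phi * m%:R - b%:R)); rewrite ?subr_gt0 ?subr_ge0 //.
  by rewrite aE; have := phi_sqr; move: phi => t t2; ring: t2.
have hi : (n + m < a.+1)%N.
  rewrite -(ltr_nat R) natrD -subr_gt0.
  apply: (sum_gt0 (a.+1%:R - phi * n%:R) (b.+1%:R - phi * m%:R)); rewrite ?subr_gt0 ?subr_ge0 ?ltW //.
  by rewrite -!natr1 aE; have := phi_sqr; move: phi => t t2; ring: t2.
by lia.
Qed.

(** Take the greatest n with phi n < a + 1. If phi n < a, then a + 1 < phi (n + 1) by irrationality,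
    and multiplying both bounds by phi gives n < phi (a - n) < n + 1, so that a = B_(a-n). *)
Lemma golden_floor_cover (a : nat) :
  (exists n, golden_floor n a) \/
  (exists m b, [/\ (0 < m)%N, golden_floor m b & a = (b + m)%N]).
Proof.
pose P n := phi * n%:R < a.+1%:R.
have P0 : P 0%N by rewrite /P mulr0 ltr0n.
have Pub n : P n -> (n <= a)%N.
  by rewrite /P -ltnS -(ltr_nat R); apply: le_lt_trans; rewrite ler_peMl // ltW // phi_gt1.
case: (ex_maxnP (ex_intro P _ P0) Pub) => n Pn n_max.
have [a_le|a_gt] := leP a%:R (phi * n%:R).
  by left; exists n; rewrite /golden_floor a_le.
have na : (n < a)%N.
  by rewrite -(ltr_nat R); apply: le_lt_trans a_gt; rewrite ler_peMl // ltW // phi_gt1.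
right; exists (a - n)%N, n; split; [by lia | | by lia].
have : ~~ P n.+1 by apply/negP => /n_max; lia.
rewrite /P -leNgt le_eqVlt => /orP[/eqP/esym/phi_irrational//|].
rewrite /golden_floor natrB 1?ltnW // -!natr1.
move=> a_lt; have t_gt0 : 0 < phi := lt_trans ltr01 phi_gt1.
apply/andP; split.
  rewrite -subr_ge0; have -> : phi * (a%:R - n%:R) - n%:R = phi * (a%:R - phi * n%:R).
    by have := phi_sqr; move: phi => t t2; ring: t2.
  by rewrite mulr_ge0 ?subr_ge0 // ltW.
rewrite -subr_gt0.
have -> : n%:R + 1 - phi * (a%:R - n%:R) = phi * (phi * (n%:R + 1) - (a%:R + 1)).
  by have := phi_sqr; move: phi => t t2; ring: t2.
by rewrite mulr_gt0 ?subr_gt0.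
Qed.

Lemma FW_setP (p : position) :
  FW_set R p <->
  p = pos 0 0 \/
  exists n a, golden_floor n a /\ p = pos a.+1 (a + n).+1.
Proof.
have sqrM n : phi ^+ 2 * n%:R = phi * n%:R + n%:R by rewrite phi_sqr mulrDl mul1r.
have floorD n : Num.floor (phi ^+ 2 * n%:R) = Num.floor (phi * n%:R) + n%:Z.
  by rewrite sqrM floorDrz ?intr_nat // -[n%:R]/(n%:Z%:~R) intrKfloor.
split=> -[->|]; [by left | | by left |].
  case=> -[n|//] _ [a [b [ea eb ->]]]; right.
  have [c nc] := golden_floor_ex n; exists n, c; split=> //.
  move: nc ea eb; rewrite golden_floor_floor floorD => /eqP <- ea eb.
  by congr pos; lia.
case=> n [a [na ->]]; right; exists n%:Z => //; exists a.+1, (a + n).+1.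
move: na; rewrite golden_floor_floor floorD => /eqP <-.
by split=> //; lia.
Qed.

End GoldenBeatty.

Lemma FW_set_stable (R : realType) (p q : position) :
  FW_set R p -> FW_move p q -> ~ FW_set R q.
Proof.
move=> /FW_setP[->|[n [a [na ->]]]] mv.
  by have := FW_move_size _ _ mv; rewrite /pos_size.
move=> /FW_setP[q0|[m [b [mb qE]]]].
  by move: mv; rewrite q0 => /FW_move_inv; lia.
(* Equal indices would make [q] equal to [p], although a move decreases the size. *)
have mn : m = n; last first.
  have ab := golden_floor_fun _ _ _ _ na; rewrite -mn in ab.
  by have := FW_move_size _ _ mv; rewrite qE -mn (ab _ mb) ltnn.
(* B_k = A_l happens only for k = l = 0. *)
have disj k l x y : golden_floor R k x -> golden_floor R l y -> y = x + k -> k = l.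
  move=> kx ly yE; rewrite yE in ly.
  have k0 := golden_floor_disjoint _ _ _ _ kx ly; rewrite k0 addn0 in kx ly *.
  exact: golden_floor_inj _ _ _ _ kx ly.
have mono := golden_floor_mono _ _ _ _ _ na mb.
have mono' := golden_floor_mono _ _ _ _ _ mb na.
rewrite qE in mv.
have [||eb|[eb|[eb|[eb|[_ eb]]]]] := FW_move_inv _ _ _ _ mv; try lia.
- by apply: disj _ _ _ _ mb na _; lia.
- by symmetry; apply: disj _ _ _ _ na mb _; lia.
Qed.

Lemma FW_set_absorbing (R : realType) (p : position) :
  ~ FW_set R p -> exists2 q, FW_move p q & FW_set R q.
Proof.
pose S a b := FW_set R (pos a b).
have move1 a b c : c < b -> S a c ->
    exists2 q, FW_move (pos a b) q & FW_set R q.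
  move=> lt_cb Sac; exists (pos a c) => //.
  by rewrite -(subKn (ltnW lt_cb)); apply: FWone; lia.
have S00 : S 0 0 by left.
have SW n a : golden_floor R n a -> S a.+1 (a + n).+1.
  by move=> na; apply/FW_setP; right; exists n, a.
rewrite (posE p); case: p => -[a b] /= le_ab nS.
case: a => [|a] in le_ab nS *.
  by apply: (move1 _ _ 0) => //; case: b nS {le_ab} => // /(_ S00).
case: b => // b in le_ab nS *.
have [[n na]|[m [c [m_gt0 mc aE]]]] := golden_floor_cover R a; last first.
  (* Here a = B_m, so the larger pile can be lowered to A_m + 1. *)
  apply: (move1 _ _ c.+1); first by lia.
  by rewrite /S posC aE; exact: SW.
have [lt_b|lt_b|bE] := ltngtP (a + n) b.
- by apply: (move1 _ _ (a + n).+1) => //; exact: SW.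
(* The difference b - a is less than n, so the candidate with this difference has smaller
   entries. *)
- have [c dc] := golden_floor_ex R (b - a).
  have lt_ca : c < a by apply: golden_floor_mono _ _ _ _ _ dc na _; lia.
  have le_na := golden_floor_ge _ _ _ na; have le_dc := golden_floor_ge _ _ _ dc.
  exists (pos (a.+1 - (a - c)) (b.+1 - (a - c))).
    (* The shift by one turns B <= 2 A into a ratio strictly below 2. *)
    have div1 x y : 0 < x -> x <= y < 2 * x -> y %/ x = 1.
      by move=> x0 xy; apply/eqP; rewrite eqn_leq -ltnS ltn_divLR // leq_divRL //; lia.
    by apply: FWboth; rewrite ?div1; lia.
  have -> : a.+1 - (a - c) = c.+1 by lia.
  have -> : b.+1 - (a - c) = (c + (b - a)).+1 by lia.
  exact: SW.
- by case: nS; rewrite -bE; exact: SW.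
Qed.

Theorem theorem5 (R : realType) (p : position) :
  P_position FW_move p <-> FW_set R p.
Proof.
apply: (P_position_kernel FW_move (FW_set R) pos_size).
- exact: FW_move_size.
- exact: FW_set_stable.
- exact: FW_set_absorbing.
Qed.
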